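(* For all $(q,r)\in\mathbb{B}^+\times\mathbb{B}^+$, the slice Bergman kernel of the quaternionic half ball $\mathbb{B}^+$ is $$K_{\mathbb{B}^+}(q,r)=(1+q^2)\left[(1-q\overline r)*(q+\overline r)\right]^{-*2}(1+\overline r^2),$$ where the $*$-product is taken with respect to the variable $q$.
   Context: $\mathbb{H}$ denotes the quaternions, $\mathbb{S}=\{I\in\mathbb{H}:I^2=-1\}$, $\mathbb{C}_I=\mathbb{R}+\mathbb{R}I$; $\mathbb{B}^+=\{q\in\mathbb{H}:|q|<1,\ \mathrm{Re}(q)>0\}$, $\mathbb{B}^+_J=\mathbb{B}^+\cap\mathbb{C}_J$. For $r\in\mathbb{B}^+\cap\mathbb{C}_J$ the slice Bergman kernel is $K_{\mathbb{B}^+}(q,r)=\mathrm{ext}[K_{\mathbb{B}^+_J}(\cdot,r)](q)$, where $K_{\mathbb{B}^+_J}(z,r)=\frac1{(1-z\overline r)^2}+\frac1{(z+\overline r)^2}$ is the complex Bergman kernel of the half disk $\mathbb{B}^+_J$ with respect to the measure $\frac1\pi dx\,dy$, and for holomorphic $g$ on $\mathbb{B}^+_J$, with $q=x+I_qy$, $z=x+Jy$, $\mathrm{ext}[g](q)=\frac12\left(g(z)+g(\overline z)\right)+\frac{I_qJ}{2}\left(g(\overline z)-g(z)\right)$. A (left) slice hyperholomorphic function on $\mathbb{B}^+$ has the form $f(x+Iy)=\alpha(x,y)+I\beta(x,y)$ for all $I\in\mathbb{S}$, with $\alpha$ even and $\beta$ odd in $y$ and satisfying the Cauchy-Riemann system;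 for $g=\gamma+I\delta$ of the same type, $f*g=(\alpha\gamma-\beta\delta)+I(\alpha\delta+\beta\gamma)$. $f^{-*}$ denotes the inverse with respect to $*$, and $f^{-*2}=(f*f)^{-*}$. *)

(* Defs.v *)
From HB Require Import structures.
From mathcomp Require Import all_boot all_order all_algebra.
From mathcomp Require Import all_classical all_reals all_analysis.
From mathcomp Require Import ring lra.

Set Implicit Arguments.
Unset Strict Implicit.
Unset Printing Implicit Defensive.

Import Order.TTheory GRing.Theory Num.Theory.
Import numFieldNormedType.Exports.

Local Open Scope classical_set_scope.
Local Open Scope ring_scope.

Record quat (R : Type) : Type := Quat { qre : R; qi : R; qj : R; qk : R }.

Definition quat_to_prod (R : Type) (q : quat R) : R * R * R * R :=
  (qre q, qi q, qj q, qk q).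

Definition quat_of_prod (R : Type) (t : R * R * R * R) : quat R :=
  let: (a, b, c, d) := t in Quat a b c d.

Lemma quat_to_prodK (R : Type) : cancel (@quat_to_prod R) (@quat_of_prod R).
Proof. by case. Qed.

HB.instance Definition _ (R : choiceType) :=
  Choice.copy (quat R) (can_type (@quat_to_prodK R)).

Definition quat_zero (R : realType) : quat R := Quat 0 0 0 0.

Definition quat_one (R : realType) : quat R := Quat 1 0 0 0.

Definition quat_opp (R : realType) (p : quat R) : quat R :=
  Quat (- qre p) (- qi p) (- qj p) (- qk p).

Definition quat_add (R : realType) (p q : quat R) : quat R :=
  Quat (qre p + qre q) (qi p + qi q) (qj p + qj q) (qk p + qk q).

Definition quat_scale (R : realType) (a : R) (p : quat R) : quat R :=
  Quat (a * qre p) (a * qi p) (a * qj p) (a * qk p).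

Definition quat_mul (R : realType) (p q : quat R) : quat R :=
  Quat (qre p * qre q - qi p * qi q - qj p * qj q - qk p * qk q)
       (qre p * qi q + qi p * qre q + qj p * qk q - qk p * qj q)
       (qre p * qj q - qi p * qk q + qj p * qre q + qk p * qi q)
       (qre p * qk q + qi p * qj q - qj p * qi q + qk p * qre q).

Definition qnormsq (R : realType) (q : quat R) : R :=
  qre q ^+ 2 + qi q ^+ 2 + qj q ^+ 2 + qk q ^+ 2.

Definition qnorm (R : realType) (q : quat R) : R := Num.sqrt (qnormsq q).

Definition qconj (R : realType) (q : quat R) : quat R :=
  Quat (qre q) (- qi q) (- qj q) (- qk q).

Definition quat_inv (R : realType) (q : quat R) : quat R :=
  quat_scale (qnormsq q)^-1 (qconj q).

Lemma quatP (R : realType) (p q : quat R) :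
  qre p = qre q -> qi p = qi q -> qj p = qj q -> qk p = qk q -> p = q.
Proof. by case: p => ? ? ? ?; case: q => ? ? ? ? /= -> -> -> ->. Qed.

Lemma quat_addA (R : realType) : associative (@quat_add R).
Proof. by move=> p q r; apply: quatP => /=; ring. Qed.
Lemma quat_addC (R : realType) : commutative (@quat_add R).
Proof. by move=> p q; apply: quatP => /=; ring. Qed.
Lemma quat_add0 (R : realType) : left_id (@quat_zero R) (@quat_add R).
Proof. by move=> p; apply: quatP => /=; ring. Qed.
Lemma quat_addN (R : realType) :
  left_inverse (@quat_zero R) (@quat_opp R) (@quat_add R).
Proof. by move=> p; apply: quatP => /=; ring. Qed.

HB.instance Definition _ (R : realType) := GRing.isZmodule.Build (quat R)
  (@quat_addA R) (@quat_addC R) (@quat_add0 R) (@quat_addN R).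

Lemma quat_mulA (R : realType) : associative (@quat_mul R).
Proof. by move=> p q r; apply: quatP => /=; ring. Qed.
Lemma quat_mul1l (R : realType) : left_id (@quat_one R) (@quat_mul R).
Proof. by move=> p; apply: quatP => /=; ring. Qed.
Lemma quat_mul1r (R : realType) : right_id (@quat_one R) (@quat_mul R).
Proof. by move=> p; apply: quatP => /=; ring. Qed.
Lemma quat_mulDl (R : realType) :
  left_distributive (@quat_mul R) (@quat_add R).
Proof. by move=> p q r; apply: quatP => /=; ring. Qed.
Lemma quat_mulDr (R : realType) :
  right_distributive (@quat_mul R) (@quat_add R).
Proof. by move=> p q r; apply: quatP => /=; ring. Qed.
Lemma quat_one_neq0 (R : realType) : @quat_one R != @quat_zero R.
Proof. by apply/eqP => -[] /eqP; rewrite oner_eq0. Qed.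

HB.instance Definition _ (R : realType) := GRing.Zmodule_isNzRing.Build (quat R)
  (@quat_mulA R) (@quat_mul1l R) (@quat_mul1r R) (@quat_mulDl R)
  (@quat_mulDr R) (@quat_one_neq0 R).

Lemma quat_scaleA (R : realType) (a b : R) (p : quat R) :
  quat_scale a (quat_scale b p) = quat_scale (a * b) p.
Proof. by apply: quatP => /=; ring. Qed.
Lemma quat_scale1 (R : realType) : left_id (1 : R) (@quat_scale R).
Proof. by move=> p; apply: quatP => /=; ring. Qed.
Lemma quat_scaleDr (R : realType) :
  right_distributive (@quat_scale R) (@quat_add R).
Proof. by move=> a p q; apply: quatP => /=; ring. Qed.
Lemma quat_scaleDl (R : realType) (p : quat R) :
  {morph (@quat_scale R)^~ p : a b / a + b >-> quat_add a b}.
Proof. by move=> a b; apply: quatP => /=; ring. Qed.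

HB.instance Definition _ (R : realType) :=
  GRing.Zmodule_isLmodule.Build R (quat R)
  (@quat_scaleA R) (@quat_scale1 R) (@quat_scaleDr R) (@quat_scaleDl R).

Lemma quat_scaleAl (R : realType) (a : R) (p q : quat R) :
  a *: (p * q) = (a *: p) * q.
Proof. by apply: quatP => /=; ring. Qed.
Lemma quat_scaleAr (R : realType) (a : R) (p q : quat R) :
  a *: (p * q) = p * (a *: q).
Proof. by apply: quatP => /=; ring. Qed.

HB.instance Definition _ (R : realType) :=
  GRing.Lmodule_isLalgebra.Build R (quat R) (@quat_scaleAl R).
HB.instance Definition _ (R : realType) :=
  GRing.Lalgebra_isAlgebra.Build R (quat R) (@quat_scaleAr R).

Lemma qnormsq_eq0 (R : realType) (q : quat R) : (qnormsq q == 0) = (q == 0).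
Proof.
apply/eqP/eqP => [|->]; last by rewrite /qnormsq /= expr0n /= !addr0.
rewrite /qnormsq => h; have := (sqr_ge0 (qre q), sqr_ge0 (qi q)).
have := (sqr_ge0 (qj q), sqr_ge0 (qk q)); case=> h3 h4 [h1 h2].
by apply: quatP => /=; apply/eqP; rewrite -sqrf_eq0; apply/eqP; lra.
Qed.

Definition quat_unit (R : realType) : pred (quat R) := fun q => q != 0.

Lemma quat_mulVq (R : realType) :
  {in @quat_unit R, left_inverse 1 (@quat_inv R) *%R}.
Proof.
move=> q; rewrite unfold_in -qnormsq_eq0 /qnormsq => h.
by apply: quatP => /=; rewrite /qnormsq; field.
Qed.
Lemma quat_mulqV (R : realType) :
  {in @quat_unit R, right_inverse 1 (@quat_inv R) *%R}.
Proof.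
move=> q; rewrite unfold_in -qnormsq_eq0 /qnormsq => h.
by apply: quatP => /=; rewrite /qnormsq; field.
Qed.
Lemma quat_unitP (R : realType) (p q : quat R) :
  q * p = 1 /\ p * q = 1 -> quat_unit p.
Proof.
case=> h _; apply/eqP => p0; move: h; rewrite p0 mulr0 => /esym/eqP.
by rewrite oner_eq0.
Qed.
Lemma quat_inv0 (R : realType) :
  {in [predC @quat_unit R], @quat_inv R =1 id}.
Proof.
by move=> q; rewrite inE negbK => /eqP ->; apply: quatP => /=; ring.
Qed.

HB.instance Definition _ (R : realType) :=
  GRing.NzRing_hasMulInverse.Build (quat R)
  (@quat_mulVq R) (@quat_mulqV R) (@quat_unitP R) (@quat_inv0 R).

Definition imag_units (R : realType) : set (quat R) :=
  [set I | I ^+ 2 = -1].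

Definition slice_pt (R : realType) (I : quat R) (x y : R) : quat R :=
  x%:A + y *: I.

Definition complex_slice (R : realType) (J : quat R) : set (quat R) :=
  [set q | exists x y : R, q = slice_pt J x y].

Definition qim (R : realType) (q : quat R) : quat R := Quat 0 (qi q) (qj q) (qk q).

Lemma imag_unitsP (R : realType) (I : quat R) :
  imag_units I -> qre I = 0 /\ qnormsq I = 1.
Proof.
rewrite /imag_units /= expr2; case: I => a b c d [] h0 h1 h2 h3.
rewrite /qnormsq /= in h0 h1 h2 h3 *.
have [a0|a0] := eqVneq a 0; first by split => //; nra.
have b0 : b = 0 by apply: (mulfI a0); nra.
have c0 : c = 0 by apply: (mulfI a0); nra.
have d0 : d = 0 by apply: (mulfI a0); nra.
by have := sqr_ge0 a; nra.
Qed.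

Lemma slice_ptN (R : realType) (I : quat R) (x y : R) :
  imag_units I -> slice_pt I x (- y) = qconj (slice_pt I x y).
Proof. by move=> /imag_unitsP[I0 _]; apply: quatP; rewrite /= ?I0; ring. Qed.

Lemma qre_slice_pt (R : realType) (I : quat R) (x y : R) :
  imag_units I -> qre (slice_pt I x y) = x.
Proof. by move=> /imag_unitsP[I0 _]; rewrite /= I0; ring. Qed.

Lemma qim_slice_pt (R : realType) (I : quat R) (x y : R) :
  imag_units I -> qim (slice_pt I x y) = y *: I.
Proof. by move=> /imag_unitsP[I0 _]; apply: quatP; rewrite /= ?I0; ring. Qed.

Lemma qnormZ (R : realType) (a : R) (q : quat R) :
  qnorm (a *: q) = `|a| * qnorm q.
Proof.
rewrite /qnorm -sqrtr_sqr -sqrtrM ?sqr_ge0 //; congr Num.sqrt.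
by rewrite /qnormsq /=; ring.
Qed.

Lemma qnorm_imag_units (R : realType) (I : quat R) :
  imag_units I -> qnorm I = 1.
Proof. by move=> /imag_unitsP[_ I1]; rewrite /qnorm I1 sqrtr1. Qed.

Lemma qnorm_slice_pt (R : realType) (I : quat R) (x y : R) :
  imag_units I -> qnorm (slice_pt I x y) = Num.sqrt (x ^+ 2 + y ^+ 2).
Proof.
move=> /imag_unitsP[I0 I1]; rewrite /qnorm; congr Num.sqrt.
have -> : x ^+ 2 + y ^+ 2 = x ^+ 2 + y ^+ 2 * qnormsq I by rewrite I1 mulr1.
by rewrite /qnormsq /= I0; ring.
Qed.

(* The decomposition q = x + I_q y with y = |Im q| >= 0. For real q every
   imaginary unit is allowed and one is fixed arbitrarily; [slice_extE] and
   [star_prodE] below show that neither this choice nor the sign of y matters. *)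
Definition imag_unit_of (R : realType) (q : quat R) : quat R :=
  if qim q == 0 then Quat 0 1 0 0 else (qnorm (qim q))^-1 *: qim q.

Lemma imag_unit_ofP (R : realType) (q : quat R) :
  imag_units (imag_unit_of q).
Proof.
rewrite /imag_units /imag_unit_of /= expr2; case: ifPn => [_|].
  by apply: quatP => /=; ring.
rewrite -qnormsq_eq0 => h.
rewrite -scalerAl -scalerAr scalerA -expr2 exprVn /qnorm sqr_sqrtr; last first.
  by rewrite /qnormsq !addr_ge0 ?sqr_ge0.
have -> : qim q * qim q = - (qnormsq (qim q))%:A.
  by apply: quatP => /=; rewrite /qnormsq /=; ring.
by rewrite scalerN scalerA mulVf // scale1r.
Qed.

Lemma slice_ptE (R : realType) (q : quat R) :
  q = slice_pt (imag_unit_of q) (qre q) (qnorm (qim q)).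
Proof.
rewrite /slice_pt /imag_unit_of; case: ifPn => [/eqP h|h].
  have -> : qnorm (qim q) = 0.
    by rewrite h /qnorm /qnormsq /= expr0n /= !addr0 sqrtr0.
  by case: q h => a b c d [-> -> ->]; apply: quatP => /=; ring.
rewrite scalerA divff ?scale1r; first by apply: quatP => /=; ring.
apply: contra h; rewrite /qnorm sqrtr_eq0 -qnormsq_eq0 eq_le => ->.
by rewrite /qnormsq !addr_ge0 ?sqr_ge0.
Qed.

Lemma imag_unit_of_slice_pt (R : realType) (I : quat R) (x y : R) :
  imag_units I -> y != 0 ->
  imag_unit_of (slice_pt I x y) = (y / `|y|) *: I.
Proof.
move=> SI y0; rewrite /imag_unit_of qim_slice_pt // qnormZ.
rewrite qnorm_imag_units // mulr1 scalerA [_ / _]mulrC; case: ifPn => // /eqP h.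
have := qnormZ y I; rewrite h (qnorm_imag_units SI) mulr1.
rewrite /qnorm /qnormsq /= expr0n /= !addr0 sqrtr0 => /esym/eqP.
by rewrite normr_eq0 (negbTE y0).
Qed.

Definition half_ball (R : realType) : set (quat R) :=
  [set q | qnorm q < 1 /\ 0 < qre q].

Definition slice_ext (R : realType) (J : quat R) (g : quat R -> quat R)
    (q : quat R) : quat R :=
  let z := slice_pt J (qre q) (qnorm (qim q)) in
  2^-1 *: (g z + g (qconj z))
  + 2^-1 *: (imag_unit_of q * J * (g (qconj z) - g z)).

Lemma slice_extE (R : realType) (J I : quat R) (g : quat R -> quat R)
    (x y : R) :
  imag_units J -> imag_units I ->
  let z := slice_pt J x y in
  slice_ext J g (slice_pt I x y) =
    2^-1 *: (g z + g (qconj z)) + 2^-1 *: (I * J * (g (qconj z) - g z)).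
Proof.
move=> SJ SI z; rewrite /slice_ext qre_slice_pt // qim_slice_pt //.
rewrite qnormZ qnorm_imag_units // mulr1 -slice_ptN // /z -slice_ptN //.
have [->|y0] := eqVneq y 0.
  by rewrite normr0 oppr0 subrr !mulr0.
rewrite imag_unit_of_slice_pt //; have [yp|yn] := ltP 0 y.
  by rewrite gtr0_norm // divff // scale1r.
rewrite ler0_norm // invrN mulrN divff // opprK scaleN1r.
by rewrite [g _ + g _]addrC -[in RHS]opprB mulrN !mulNr.
Qed.

(* Bergman kernel of the half disk of C_J for the measure (1/pi) dx dy; z and r
   are meant to lie in the same C_J, which is a commutative subfield. *)
Definition half_disk_bergman (R : realType) (z r : quat R) : quat R :=
  (1 - z * qconj r) ^- 2 + (z + qconj r) ^- 2.

Definition slice_bergman (R : realType) (J q r : quat R) : quat R :=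
  slice_ext J (fun z => half_disk_bergman z r) q.

(* Points (x, y) of the plane with x + I y in U for some (for an axially
   symmetric U, equivalently for every) imaginary unit I. *)
Definition plane_trace (R : realType) (U : set (quat R)) : set (R * R) :=
  [set p | exists2 I, imag_units I & U (slice_pt I p.1 p.2)].

Definition cauchy_riemann (R : realType) (a b : R * R -> R) (p : R * R) : Prop :=
  [/\ differentiable a p, differentiable b p,
      'D_((1, 0) : R * R) a p = 'D_((0, 1) : R * R) b p &
      'D_((0, 1) : R * R) a p = - 'D_((1, 0) : R * R) b p].

Definition qcauchy_riemann (R : realType) (alpha beta : R * R -> quat R)
    (p : R * R) : Prop :=
  [/\ cauchy_riemann (@qre R \o alpha) (@qre R \o beta) p,
      cauchy_riemann (@qi R \o alpha) (@qi R \o beta) p,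
      cauchy_riemann (@qj R \o alpha) (@qj R \o beta) p &
      cauchy_riemann (@qk R \o alpha) (@qk R \o beta) p].

Definition slice_components (R : realType) (U : set (quat R))
    (f : quat R -> quat R) (alpha beta : R * R -> quat R) : Prop :=
  (forall x y, plane_trace U (x, y) ->
     alpha (x, - y) = alpha (x, y) /\ beta (x, - y) = - beta (x, y)) /\
  (forall I x y, imag_units I -> U (slice_pt I x y) ->
     f (slice_pt I x y) = alpha (x, y) + I * beta (x, y)).

Definition slice_hyperholomorphic (R : realType) (U : set (quat R))
    (f : quat R -> quat R) : Prop :=
  exists alpha beta : R * R -> quat R,
    slice_components U f alpha beta /\
    (forall p, plane_trace U p -> qcauchy_riemann alpha beta p).

(* The components alpha, beta of f = alpha + I beta are recovered from the
   values of f at the two points x + I y and x - I y; see [star_prodE]. *)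
Definition slice_alpha (R : realType) (I : quat R) (f : quat R -> quat R)
    (x y : R) : quat R :=
  2^-1 *: (f (slice_pt I x y) + f (slice_pt I x (- y))).

Definition slice_beta (R : realType) (I : quat R) (f : quat R -> quat R)
    (x y : R) : quat R :=
  2^-1 *: (I * (f (slice_pt I x (- y)) - f (slice_pt I x y))).

Definition star_prod (R : realType) (f g : quat R -> quat R) (q : quat R) : quat R :=
  let I := imag_unit_of q in
  let x := qre q in
  let y := qnorm (qim q) in
  let alpha := slice_alpha I f x y in
  let beta := slice_beta I f x y in
  let gamma := slice_alpha I g x y in
  let delta := slice_beta I g x y in
  (alpha * gamma - beta * delta) + I * (alpha * delta + beta * gamma).

Definition is_star_inverse (R : realType) (U : set (quat R))
    (f g : quat R -> quat R) : Prop :=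
  slice_hyperholomorphic U g /\
  (forall q, U q -> star_prod f g q = 1 /\ star_prod g f q = 1).

Definition star_invertible (R : realType) (U : set (quat R))
    (f : quat R -> quat R) : Prop :=
  exists g, is_star_inverse U f g.

(* Only the values on U are meaningful: they are unique, as * is associative
   on slice hyperholomorphic functions. *)
Definition star_inv (R : realType) (U : set (quat R))
    (f : quat R -> quat R) : quat R -> quat R :=
  xget (fun=> 0) [set g | is_star_inverse U f g].

Definition star_inv_sq (R : realType) (U : set (quat R))
    (f : quat R -> quat R) : quat R -> quat R :=
  star_inv U (star_prod f f).

Lemma half_ball_slice_pt (R : realType) (I K : quat R) (x y : R) :
  imag_units I -> imag_units K ->
  half_ball (slice_pt I x y) -> half_ball (slice_pt K x y).
Proof.
by move=> SI SK []; rewrite qnorm_slice_pt // qre_slice_pt // => hn hx;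
  split; rewrite ?qnorm_slice_pt ?qre_slice_pt.
Qed.

Lemma slice_alphaE (R : realType) (f : quat R -> quat R)
    (alpha beta : R * R -> quat R) (I K : quat R) (x y : R) :
  slice_components (@half_ball R) f alpha beta ->
  imag_units I -> imag_units K -> half_ball (slice_pt K x y) ->
  slice_alpha I f x y = alpha (x, y) /\ slice_beta I f x y = beta (x, y).
Proof.
move=> [eo fE] SI SK hK; have hI := half_ball_slice_pt SK SI hK.
have hIN : half_ball (slice_pt I x (- y)).
  have [] := hI; rewrite !qnorm_slice_pt // !qre_slice_pt // => h1 h2.
  by split; rewrite ?qre_slice_pt // qnorm_slice_pt // sqrrN.
have tI : plane_trace (@half_ball R) (x, y) by exists I.
have [aN bN] := eo _ _ tI.
rewrite /slice_alpha /slice_beta !fE // aN bN mulrN.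
have two (p : quat R) : 2^-1 *: (p + p) = p.
  by apply: quatP => /=; field.
split; first by rewrite addrACA subrr addr0 two.
have -> : alpha (x, y) - I * beta (x, y) - (alpha (x, y) + I * beta (x, y))
    = - (I * beta (x, y) + I * beta (x, y)).
  by rewrite opprD addrACA subrr add0r opprD.
by rewrite mulrN mulrDr mulrA -expr2 SI mulN1r -opprD opprK two.
Qed.

Lemma star_prodE (R : realType) (f g : quat R -> quat R)
    (alpha beta gamma delta : R * R -> quat R) (I : quat R) (x y : R) :
  slice_components (@half_ball R) f alpha beta ->
  slice_components (@half_ball R) g gamma delta ->
  imag_units I -> half_ball (slice_pt I x y) ->
  let p := (x, y) in
  star_prod f g (slice_pt I x y) =
    (alpha p * gamma p - beta p * delta p)
    + I * (alpha p * delta p + beta p * gamma p).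
Proof.
move=> hf hg SI hI p; rewrite /star_prod.
rewrite qre_slice_pt // qim_slice_pt // qnormZ qnorm_imag_units // mulr1.
have Sq := imag_unit_ofP (slice_pt I x y).
have tI : plane_trace (@half_ball R) (x, y) by exists I.
have [aN bN] := hf.1 _ _ tI; have [cN dN] := hg.1 _ _ tI.
have hIN : half_ball (slice_pt I x (- y)).
  have [] := hI; rewrite !qnorm_slice_pt // !qre_slice_pt // => h1 h2.
  by split; rewrite ?qre_slice_pt // qnorm_slice_pt // sqrrN.
have [y0|y0] := leP 0 y.
  rewrite ger0_norm //.
  have [-> ->] := slice_alphaE hf Sq SI hI.
  have [-> ->] := slice_alphaE hg Sq SI hI.
  have [y00|yn] := eqVneq y 0; last first.
    by rewrite imag_unit_of_slice_pt // ger0_norm // divff // scale1r.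
  have z0 (u : quat R) : u = - u -> u = 0.
    by move=> h; case: u h => a b c d [*]; apply: quatP => /=; lra.
  have b0 : beta p = 0 by apply: z0; rewrite -bN y00 oppr0 /p y00.
  have d0 : delta p = 0 by apply: z0; rewrite -dN y00 oppr0 /p y00.
  by rewrite -/p b0 d0 !mulr0 !mul0r addr0 !mulr0.
rewrite ltr0_norm //.
have [-> ->] := slice_alphaE hf Sq SI hIN.
have [-> ->] := slice_alphaE hg Sq SI hIN.
rewrite imag_unit_of_slice_pt ?lt_eqF // ltr0_norm // invrN mulrN divff ?lt_eqF //.
rewrite aN bN cN dN scaleN1r mulrNN.
by rewrite (mulrN (alpha _)) (mulNr _ (gamma _)) -opprD mulrNN.
Qed.

(* Main.v *)
Require Import Defs.
From mathcomp Require Import all_boot all_order all_algebra.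
From mathcomp Require Import all_classical all_reals all_analysis.
From mathcomp Require Import ring lra.

Set Implicit Arguments.
Unset Strict Implicit.
Unset Printing Implicit Defensive.

Import Order.TTheory GRing.Theory Num.Theory.
Import numFieldNormedType.Exports.

Local Open Scope ring_scope.

(** Write [c] for the conjugate of [r] and [z] for the point of [C_J] with the
same real coordinates as [q].  Both lie in the commutative field [C_J], so on
the half disk the two terms of the Bergman kernel can be put over a common
denominator: with [u z = (1 - z c)(z + c)],
  [(1 - z c)^-2 + (z + c)^-2 = (1 + z^2) (u z * u z)^-1 (1 + c^2)],
because [(1 - z c)^2 + (z + c)^2 = (1 + z^2)(1 + c^2)]
([sum_inv_sqr_factor]).  It remains to see what the slice extension does to
each factor.

The extension turns pointwise products of [C_J]-valued functions into star
products ([slice_extM]): the components of [slice_ext J g] are the half sum of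
[g z] and [g z'] and [J] times their half difference, [z'] being the conjugate
of [z], and [alpha + J beta], [alpha - J beta] recover the two values.
Functions affine in [q], with coefficients on the right, are their own
extensions ([slice_ext_affine]); hence [F] is the extension of [u] on the half
ball ([star_prod_affine]), [F * F] is that of [u^2], and its star inverse is
that of [u^-2] ([slice_ext_star_inverse]).  Star inverses are unique on the
half ball ([star_inverse_unique]), by associativity, so the arbitrary choice
made by [star_inv] is harmless.  Finally [1 + q^2] has real coefficients, so
multiplication by it on the left is an ordinary product that commutes with the
extension ([slice_ext_intrinsicM]), and the constant [1 + c^2] goes out on the
right ([slice_extMr]).

The analytic content is that the extension of [u^-2] satisfies the
Cauchy-Riemann system ([slice_ext_hyperholomorphic]).  For this, functions of
the plane with values in the commutant of [K] and with derivative in [y] equal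
to [K] times the derivative in [x] are shown to be closed under ring
operations and inverse; this is used with [K = J], and with [K = - J] to read
the function at the conjugate point. *)

(** * Partial derivatives of quaternion-valued functions of the plane *)

Definition partials (R : realType) (f : R * R -> R) (p : R * R) (a b : R) :=
  [/\ differentiable f p, 'D_((1, 0) : R * R) f p = a &
      'D_((0, 1) : R * R) f p = b].

Lemma partials_eq (R : realType) (f : R * R -> R) p a b a' b' :
  partials f p a b -> a = a' -> b = b' -> partials f p a' b'.
Proof. by move=> h <- <-. Qed.

Lemma partials_cst (R : realType) (c : R) p : partials (fun=> c) p 0 0.
Proof.
split; first exact: differentiable_cst.
  exact: (derive_cst c).
exact: (derive_cst c).
Qed.

Lemma partials_linear (R : realType) (f : {linear (R * R)%type -> R}) p :
  continuous f -> partials f p (f (1, 0)) (f (0, 1)).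
Proof.
move=> fc; have df := linear_differentiable p fc.
by split => //; rewrite deriveE // diff_lin.
Qed.

Lemma partials_fst (R : realType) (p : R * R) : partials (fun s => s.1) p 1 0.
Proof. by apply: (partials_linear (f := fst)) => s; exact: cvg_fst. Qed.

Lemma partials_snd (R : realType) (p : R * R) : partials (fun s => s.2) p 0 1.
Proof. by apply: (partials_linear (f := snd)) => s; exact: cvg_snd. Qed.

Lemma partialsD (R : realType) (f g : R * R -> R) p a b c d :
  partials f p a b -> partials g p c d ->
  partials (fun s => f s + g s) p (a + c) (b + d).
Proof.
move=> [df <- <-] [dg <- <-]; split; first exact: differentiableD.
  by apply: deriveD; exact: diff_derivable.
by apply: deriveD; exact: diff_derivable.
Qed.

Lemma partialsN (R : realType) (f : R * R -> R) p a b :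
  partials f p a b -> partials (fun s => - f s) p (- a) (- b).
Proof.
move=> [df <- <-]; split; first exact: differentiableN.
  by apply: deriveN; exact: diff_derivable.
by apply: deriveN; exact: diff_derivable.
Qed.

Lemma partialsM (R : realType) (f g : R * R -> R) p a b c d :
  partials f p a b -> partials g p c d ->
  partials (fun s => f s * g s) p (f p * c + g p * a) (f p * d + g p * b).
Proof.
move=> [df <- <-] [dg <- <-]; split; first exact: differentiableM.
  by apply: deriveM; exact: diff_derivable.
by apply: deriveM; exact: diff_derivable.
Qed.

Lemma partialsV (R : realType) (f : R * R -> R) p a b :
  f p != 0 -> partials f p a b ->
  partials (fun s => (f s)^-1) p (- (f p) ^- 2 * a) (- (f p) ^- 2 * b).
Proof.
move=> fp [df <- <-]; split; first exact: differentiableV.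
  by apply: deriveV => //; exact: diff_derivable.
by apply: deriveV => //; exact: diff_derivable.
Qed.

Definition quat_partials (R : realType) (g : R * R -> quat R) (p : R * R)
    (A B : quat R) :=
  [/\ partials (fun s => qre (g s)) p (qre A) (qre B),
      partials (fun s => qi (g s)) p (qi A) (qi B),
      partials (fun s => qj (g s)) p (qj A) (qj B) &
      partials (fun s => qk (g s)) p (qk A) (qk B)].

(** Differentiates a real expression built from known functions, and leaves the
equations between the partials so obtained and the expected ones. *)
Ltac compute_partials :=
  (eapply partials_eq; [
  repeat first [ eassumption
    | apply: partials_cst | apply: partials_fst | apply: partials_snd
    | (eapply partialsD) | (eapply partialsN) | (eapply partialsM) ]
  | | ]).

Lemma quat_partials_cst (R : realType) (c : quat R) p :
  quat_partials (fun=> c) p 0 0.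
Proof. by split; exact: partials_cst. Qed.

Lemma quat_partials_slice_pt (R : realType) (K : quat R) p :
  quat_partials (fun s => slice_pt K s.1 s.2) p 1 K.
Proof.
by split => /=; compute_partials => /=; ring.
Qed.

Lemma quat_partialsD (R : realType) (f g : R * R -> quat R) p A B C D :
  quat_partials f p A B -> quat_partials g p C D ->
  quat_partials (fun s => f s + g s) p (A + C) (B + D).
Proof. by move=> [? ? ? ?] [? ? ? ?]; split; exact: partialsD. Qed.

Lemma quat_partialsN (R : realType) (f : R * R -> quat R) p A B :
  quat_partials f p A B -> quat_partials (fun s => - f s) p (- A) (- B).
Proof. by move=> [? ? ? ?]; split; exact: partialsN. Qed.

Lemma quat_partialsM (R : realType) (f g : R * R -> quat R) p A B C D :
  quat_partials f p A B -> quat_partials g p C D ->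
  quat_partials (fun s => f s * g s) p (A * g p + f p * C) (B * g p + f p * D).
Proof.
by move=> [? ? ? ?] [? ? ? ?]; split => /=; compute_partials => /=; ring.
Qed.

Lemma partials_qnormsq (R : realType) (f : R * R -> quat R) p A B :
  quat_partials f p A B ->
  partials (fun s => qnormsq (f s)) p
    (2 * (qre (f p) * qre A + qi (f p) * qi A + qj (f p) * qj A
          + qk (f p) * qk A))
    (2 * (qre (f p) * qre B + qi (f p) * qi B + qj (f p) * qj B
          + qk (f p) * qk B)).
Proof.
case=> ? ? ? ?; have -> : (fun s => qnormsq (f s)) = fun s =>
    qre (f s) * qre (f s) + qi (f s) * qi (f s) + qj (f s) * qj (f s)
    + qk (f s) * qk (f s) by apply/funext => s; rewrite /qnormsq !expr2.
by compute_partials => /=; ring.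
Qed.

(** In a noncommutative ring [d(f^-1) = - f^-1 df f^-1]; checked here on the
components of [qconj f / qnormsq f]. *)
Lemma quat_partialsV (R : realType) (f : R * R -> quat R) p A B :
  f p != 0 -> quat_partials f p A B ->
  quat_partials (fun s => (f s)^-1) p (- ((f p)^-1 * A * (f p)^-1))
    (- ((f p)^-1 * B * (f p)^-1)).
Proof.
rewrite -qnormsq_eq0 => fp hf.
have hn := partialsV fp (partials_qnormsq hf); case: hf => h0 h1 h2 h3.
split => /=; compute_partials => /=; rewrite /qnormsq in fp *; field; exact: fp.
Qed.

(** * Holomorphy along a slice *)

(** For an imaginary unit [K], the commutant of [K] is the field [C_K] and the
second clause is the complex differentiability of [g], as a function of
[x + K y], with derivative [A]. Commutation of the values with [K] is what
makes the class stable under products. *)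
Definition holomorphic_at (R : realType) (K : quat R) (g : R * R -> quat R)
    (p : R * R) :=
  GRing.comm K (g p) /\ exists A, quat_partials g p A (K * A).

Lemma holomorphic_at_cst (R : realType) (K c : quat R) p :
  GRing.comm K c -> holomorphic_at K (fun=> c) p.
Proof.
by split => //; exists 0; rewrite mulr0; exact: quat_partials_cst.
Qed.

Lemma slice_pt_comm (R : realType) (K c : quat R) x y :
  GRing.comm K c -> GRing.comm (slice_pt K x y) c.
Proof.
move=> Kc; rewrite /GRing.comm /slice_pt mulrDl mulrDr -!scalerAl -!scalerAr.
by rewrite mul1r mulr1 Kc.
Qed.

Lemma comm_slice_pt (R : realType) (K : quat R) x y :
  GRing.comm K (slice_pt K x y).
Proof. by apply/commr_sym/slice_pt_comm. Qed.

Lemma holomorphic_at_slice_pt (R : realType) (K : quat R) p :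
  holomorphic_at K (fun s => slice_pt K s.1 s.2) p.
Proof.
split; first exact: comm_slice_pt.
by exists 1; rewrite mulr1; exact: quat_partials_slice_pt.
Qed.

Lemma holomorphic_atD (R : realType) (K : quat R) (f g : R * R -> quat R) p :
  holomorphic_at K f p -> holomorphic_at K g p ->
  holomorphic_at K (fun s => f s + g s) p.
Proof.
move=> [cf [A hA]] [cg [B hB]]; split; first exact: commrD.
by exists (A + B); rewrite mulrDr; exact: quat_partialsD.
Qed.

Lemma holomorphic_atN (R : realType) (K : quat R) (f : R * R -> quat R) p :
  holomorphic_at K f p -> holomorphic_at K (fun s => - f s) p.
Proof.
move=> [cf [A hA]]; split; first exact: commrN.
by exists (- A); rewrite mulrN; exact: quat_partialsN.
Qed.

Lemma holomorphic_atM (R : realType) (K : quat R) (f g : R * R -> quat R) p :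
  holomorphic_at K f p -> holomorphic_at K g p ->
  holomorphic_at K (fun s => f s * g s) p.
Proof.
move=> [cf [A hA]] [cg [B hB]]; split; first exact: commrM.
exists (A * g p + f p * B); rewrite mulrDr !mulrA cf -(mulrA (f p)).
exact: quat_partialsM.
Qed.

Lemma holomorphic_atV (R : realType) (K : quat R) (f : R * R -> quat R) p :
  f p != 0 -> holomorphic_at K f p -> holomorphic_at K (fun s => (f s)^-1) p.
Proof.
move=> fp [cf [A hA]]; have cV : GRing.comm K (f p)^-1 by exact: commrV.
split=> //; exists (- ((f p)^-1 * A * (f p)^-1)).
by rewrite mulrN !mulrA cV -(mulrA _ K); exact: quat_partialsV.
Qed.

Lemma quat_partials_cauchy_riemann (R : realType) (a b : R * R -> quat R)
    p A B :
  quat_partials a p A B -> quat_partials b p (- B) A -> qcauchy_riemann a b p.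
Proof.
move=> [[? e0 e0'] [? e1 e1'] [? e2 e2'] [? e3 e3']].
move=> [[? d0 d0'] [? d1 d1'] [? d2 d2'] [? d3 d3']].
split; split => //; rewrite /comp.
- by rewrite e0 d0'.
- by rewrite e0' d0 /= opprK.
- by rewrite e1 d1'.
- by rewrite e1' d1 /= opprK.
- by rewrite e2 d2'.
- by rewrite e2' d2 /= opprK.
- by rewrite e3 d3'.
- by rewrite e3' d3 /= opprK.
Qed.

(** Holomorphy on the half disk of [C_J], of [g] itself and of [g] composed with
the conjugation, which is [g] read along [- J]. *)
Definition slice_holomorphic (R : realType) (J : quat R)
    (g : quat R -> quat R) :=
  forall K p, K = J \/ K = - J -> half_ball (slice_pt K p.1 p.2) ->
    holomorphic_at K (fun s => g (slice_pt K s.1 s.2)) p.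

(** * The slice extension *)

(** The components of the slice extension of [g]; the conjugate of
[slice_pt J x y] is written [slice_pt (- J) x y], so that both values of [g]
have the form required by [holomorphic_at]. *)
Definition ext_alpha (R : realType) (J : quat R) (g : quat R -> quat R)
    (p : R * R) : quat R :=
  2^-1 *: (g (slice_pt J p.1 p.2) + g (slice_pt (- J) p.1 p.2)).

Definition ext_beta (R : realType) (J : quat R) (g : quat R -> quat R)
    (p : R * R) : quat R :=
  2^-1 *: (J * (g (slice_pt (- J) p.1 p.2) - g (slice_pt J p.1 p.2))).

Lemma imag_unitsN (R : realType) (J : quat R) :
  imag_units J -> imag_units (- J).
Proof. by rewrite /imag_units /= sqrrN. Qed.

Lemma slice_pt_opp (R : realType) (J : quat R) x y :
  slice_pt (- J) x y = slice_pt J x (- y).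
Proof. by rewrite /slice_pt scalerN scaleNr. Qed.

Lemma slice_ext_components (R : realType) (U : set (quat R)) (J : quat R) g :
  imag_units J ->
  slice_components U (slice_ext J g) (ext_alpha J g) (ext_beta J g).
Proof.
move=> SJ; split=> [x y _|I x y SI _].
  rewrite /ext_alpha /ext_beta /= !slice_pt_opp opprK [g _ + _]addrC.
  by rewrite -scalerN -mulrN opprB.
rewrite slice_extE // -slice_ptN // /ext_alpha /ext_beta /= slice_pt_opp.
by rewrite -scalerAr mulrA.
Qed.

(** If [h1] and [h2] are the values of [g] at a point and at its conjugate, then
[d_y h1 = J d_x h1] and [d_y h2 = - J d_x h2], and the Cauchy-Riemann system for
[(h1 + h2) / 2] and [J (h2 - h1) / 2] follows from [J^2 = -1]. *)
Lemma slice_ext_hyperholomorphic (R : realType) (J : quat R)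
    (g : quat R -> quat R) :
  imag_units J -> slice_holomorphic J g ->
  slice_hyperholomorphic (@half_ball R) (slice_ext J g).
Proof.
move=> SJ hol; exists (ext_alpha J g), (ext_beta J g); split.
  exact: slice_ext_components.
move=> p [I SI hI].
have [_ [A hA]] := hol J p (or_introl erefl) (half_ball_slice_pt SI SJ hI).
have [_ [B hB]] := hol (- J) p (or_intror erefl)
  (half_ball_slice_pt SI (imag_unitsN SJ) hI).
have cZ (c : quat R) := quat_partials_cst c p.
have JJ X : J * (J * X) = - X by rewrite mulrA -expr2 SJ mulN1r.
have ha := quat_partialsM (cZ 2^-1%:A) (quat_partialsD hA hB).
have hb := quat_partialsM (cZ 2^-1%:A)
  (quat_partialsM (cZ J) (quat_partialsD hB (quat_partialsN hA))).
apply: (@quat_partials_cauchy_riemann _ _ _ _ (2^-1 *: (A + B))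
  (2^-1 *: (J * (A - B)))).
- have -> : ext_alpha J g = fun s => 2^-1%:A *
      (g (slice_pt J s.1 s.2) + g (slice_pt (- J) s.1 s.2)).
    by apply/funext => s; rewrite -scalerAl mul1r.
  by move: ha; rewrite !mul0r !add0r -!scalerAl !mul1r mulrBr mulNr.
- have -> : ext_beta J g = fun s => 2^-1%:A *
      (J * (g (slice_pt (- J) s.1 s.2) - g (slice_pt J s.1 s.2))).
    by apply/funext => s; rewrite -scalerAl mul1r.
  move: hb; rewrite !mul0r !add0r -!scalerAl !mul1r.
  rewrite mulNr -opprD -mulrDr mulrN JJ opprK.
  by rewrite -scalerN -mulrN opprB [B + A]addrC.
Qed.

Lemma slice_extMr (R : realType) (J c : quat R) (g : quat R -> quat R) q :
  slice_ext J (fun z => g z * c) q = slice_ext J g q * c.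
Proof.
rewrite /slice_ext [RHS]mulrDl -[X in _ = X + _]scalerAl.
by rewrite -[X in _ = _ + X]scalerAl -mulrDl -mulrBl !mulrA.
Qed.

Lemma slice_ext_cst (R : realType) (J c : quat R) q :
  slice_ext J (fun=> c) q = c.
Proof.
by rewrite /slice_ext subrr mulr0 scaler0 addr0; apply: quatP => /=; field.
Qed.

Lemma slice_extD (R : realType) (J : quat R) (f g : quat R -> quat R) q :
  slice_ext J (fun z => f z + g z) q = slice_ext J f q + slice_ext J g q.
Proof.
rewrite /slice_ext [RHS]addrACA -!scalerDr -mulrDr.
by congr (_ *: (_ + _ * _)); rewrite ?opprD addrACA.
Qed.

(** The hypothesis on [phi] says that it is intrinsic, i.e. that its components
are real: they are then central, and multiplying by [phi q] acts on the
components of the extension as multiplying by [phi z] does on the slice. *)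
Lemma slice_ext_intrinsicM (R : realType) (J : quat R) (A B : R -> R -> R)
    (phi g : quat R -> quat R) q :
  imag_units J ->
  (forall K x y, imag_units K ->
     phi (slice_pt K x y) = slice_pt K (A x y) (B x y)) ->
  slice_ext J (fun z => phi z * g z) q = phi q * slice_ext J g q.
Proof.
move=> SJ phiE; have SI := imag_unit_ofP q.
rewrite [in phi q](slice_ptE q) /slice_ext -slice_ptN // -slice_pt_opp.
rewrite !phiE //; last exact: imag_unitsN.
move: (A _ _) (B _ _) (g _) (g _) (imag_unit_of q) SI => a b g1 g2 I SI.
have sptM K X : slice_pt K a b * X = a *: X + b *: (K * X).
  by rewrite mulrDl -!scalerAl mul1r.
have JJ X : J * (J * X) = - X by rewrite mulrA -expr2 SJ mulN1r.
have II X : I * (I * X) = - X by rewrite mulrA -expr2 SI mulN1r.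
rewrite !sptM.
rewrite !(mulrDr, mulrN, mulNr, opprD, opprK, scalerDr, scalerN, scalerA).
rewrite !(=^~ scalerAr, =^~ mulrA, mulrN, scalerN, opprK, JJ, II).
(* The goal is now linear in these products, which become unknowns. *)
move: (I * (J * g1)) (I * (J * g2)) (I * g1) (I * g2) (J * g1) (J * g2).
by move=> *; apply: quatP => /=; field.
Qed.

(** The representation formula for affine functions, the linear part being the
intrinsic identity function times a constant. *)
Lemma slice_ext_affine (R : realType) (J c d : quat R) q :
  imag_units J -> slice_ext J (fun z => z * c + d) q = q * c + d.
Proof.
move=> SJ; rewrite slice_extD slice_ext_cst.
rewrite (@slice_ext_intrinsicM _ _ (fun x _ => x) (fun _ y => y) id) //.
by rewrite slice_ext_cst.
Qed.

Lemma slice_pt_1Dsqr (R : realType) (K : quat R) x y :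
  imag_units K ->
  1 + slice_pt K x y ^+ 2 = slice_pt K (1 + x ^+ 2 - y ^+ 2) (2 * x * y).
Proof.
move=> SK; rewrite expr2 {1}/slice_pt mulrDl -scalerAl mul1r -scalerAl.
rewrite mulrDr -!scalerAr mulr1 -[K * K]expr2 SK.
by apply: quatP => /=; ring.
Qed.

(** * The star product on the half ball *)

Lemma half_ballN (R : realType) (I : quat R) (x y : R) :
  imag_units I -> half_ball (slice_pt I x y) -> half_ball (slice_pt I x (- y)).
Proof.
move=> SI; rewrite -slice_pt_opp; apply: half_ball_slice_pt => //.
exact: imag_unitsN.
Qed.

Lemma half_ball_change_unit (R : realType) (K q : quat R) :
  imag_units K -> half_ball q ->
  half_ball (slice_pt K (qre q) (qnorm (qim q))).
Proof.
move=> SK; rewrite {1}[q]slice_ptE; apply: half_ball_slice_pt => //.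
exact: imag_unit_ofP.
Qed.

(** The star product at [q] only involves the values at the points [x + I y] and
[x - I y], which stay in the half ball. *)
Lemma eq_star_prod (R : realType) (f f' g g' : quat R -> quat R) q :
  (forall s, half_ball s -> f s = f' s) ->
  (forall s, half_ball s -> g s = g' s) ->
  half_ball q -> star_prod f g q = star_prod f' g' q.
Proof.
move=> ff gg hq; rewrite /star_prod /slice_alpha /slice_beta.
have SI := imag_unit_ofP q; have h1 := half_ball_change_unit SI hq.
by have h2 := half_ballN SI h1; rewrite !ff ?gg.
Qed.

Lemma eq_slice_ext (R : realType) (J : quat R) (f g : quat R -> quat R) q :
  imag_units J ->
  (forall x y, half_ball (slice_pt J x y) ->
     f (slice_pt J x y) = g (slice_pt J x y)) ->
  half_ball q -> slice_ext J f q = slice_ext J g q.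
Proof.
move=> SJ fg hq; rewrite /slice_ext -slice_ptN //.
have h1 := half_ball_change_unit SJ hq; have h2 := half_ballN SJ h1.
by rewrite !fg.
Qed.

Lemma slice_components_star (R : realType) (f g : quat R -> quat R)
    (a b c d : R * R -> quat R) :
  slice_components (@half_ball R) f a b ->
  slice_components (@half_ball R) g c d ->
  slice_components (@half_ball R) (star_prod f g)
    (fun p => a p * c p - b p * d p) (fun p => a p * d p + b p * c p).
Proof.
move=> hf hg; split=> [x y h|I x y SI h]; last exact: (star_prodE hf hg).
have [-> ->] := hf.1 _ _ h; have [-> ->] := hg.1 _ _ h.
by rewrite mulrNN mulrN mulNr -opprD.
Qed.

(** On components the star product is the multiplication of the complexification
of the quaternions, which is associative. *)
Lemma star_prodA (R : realType) (f g h : quat R -> quat R)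
    (a b c d m n : R * R -> quat R) q :
  slice_components (@half_ball R) f a b ->
  slice_components (@half_ball R) g c d ->
  slice_components (@half_ball R) h m n -> half_ball q ->
  star_prod f (star_prod g h) q = star_prod (star_prod f g) h q.
Proof.
move=> hf hg hh hq; have SI := imag_unit_ofP q.
rewrite [q]slice_ptE in hq *.
rewrite (star_prodE hf (slice_components_star hg hh)) //.
rewrite (star_prodE (slice_components_star hf hg) hh) //=.
set p := (_, _).
congr (_ + _ * _); rewrite !(mulrDl, mulrDr, mulrN, mulNr, mulrA).
  by rewrite !opprD !addrA 2!(addrAC _ (- (b p * d p * m p))).
by rewrite !addrA 2!(addrAC _ (- (b p * d p * n p))).
Qed.

Lemma star_prod1 (R : realType) (f : quat R -> quat R) (a b : R * R -> quat R)
    q :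
  slice_components (@half_ball R) f a b -> half_ball q ->
  star_prod f (fun=> 1) q = f q /\ star_prod (fun=> 1) f q = f q.
Proof.
move=> hf hq; have SI := imag_unit_ofP q.
have h1 : slice_components (@half_ball R) (fun=> 1) (fun=> 1) (fun=> 0).
  by split=> [x y _|I x y _ _]; rewrite ?oppr0 ?mulr0 ?addr0.
have fE := hf.2 _ _ _ SI; rewrite [q]slice_ptE in hq *.
rewrite (star_prodE hf h1) // (star_prodE h1 hf) // fE //.
by rewrite !(mulr0, mul0r, mulr1, mul1r, subr0, add0r, addr0).
Qed.

(** For two inverses [g] and [h], [g = g * (f * h) = (g * f) * h = h]. *)
Lemma star_inverse_unique (R : realType) (f g h : quat R -> quat R)
    (a b : R * R -> quat R) q :
  slice_components (@half_ball R) f a b ->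
  is_star_inverse (@half_ball R) f g -> is_star_inverse (@half_ball R) f h ->
  half_ball q -> g q = h q.
Proof.
move=> hf [[c [d [hg _]]] gf] [[m [n [hh _]]] fh] hq.
rewrite -(star_prod1 hg hq).1 -(star_prod1 hh hq).2.
transitivity (star_prod g (star_prod f h) q).
  by apply: eq_star_prod => // s /fh[].
rewrite (star_prodA hg hf hh hq); apply: eq_star_prod => // s.
by move=> /gf[].
Qed.

Lemma star_invE (R : realType) (f g : quat R -> quat R)
    (a b : R * R -> quat R) q :
  slice_components (@half_ball R) f a b ->
  is_star_inverse (@half_ball R) f g -> half_ball q ->
  star_inv (@half_ball R) f q = g q.
Proof.
move=> hf fg hq; apply: (star_inverse_unique hf _ fg hq).
by apply: (@xgetPex _ _ (is_star_inverse _ _)); exists g.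
Qed.

(** With [f1], [f2] the values of [f] at [z] and its conjugate, and likewise for
[g], the components of the star product are [(f1 g1 + f2 g2) / 2] and
[J (f2 g2 - f1 g1) / 2], once every [J] has been moved to the front across a
value of [f]. *)
Lemma slice_extM (R : realType) (J : quat R) (f g : quat R -> quat R) q :
  imag_units J ->
  (forall x y, half_ball (slice_pt J x y) ->
     GRing.comm J (f (slice_pt J x y))) ->
  half_ball q ->
  star_prod (slice_ext J f) (slice_ext J g) q
    = slice_ext J (fun z => f z * g z) q.
Proof.
move=> SJ cf hq; have SI := imag_unit_ofP q.
have hz := half_ball_change_unit SJ hq; have hz' := half_ballN SJ hz.
have [cz cz'] := (cf _ _ hz, cf _ _ hz').
have hE (k : quat R -> quat R) := slice_ext_components (@half_ball R) k SJ.
have hqI := half_ball_change_unit SI hq.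
have := star_prodE (hE f) (hE g) SI hqI.
have := (hE (fun z => f z * g z)).2 _ _ _ SI hqI; rewrite -slice_ptE => -> ->.
rewrite /ext_alpha /ext_beta /= slice_pt_opp.
move: cz cz'; set z := slice_pt J _ (qnorm _); set z' := slice_pt J _ (- _).
move: (f z) (f z') (g z) (g z') => f1 f2 g1 g2 c1 c2.
have JJ : J * J = -1 by rewrite -expr2 SJ.
have cB : GRing.comm J (f2 - f1) by exact: commrB.
have cD : GRing.comm J (f1 + f2) by exact: commrD.
rewrite -!scalerAl -!scalerAr !scalerA (mulrA (J * _)) {1}cB -(mulrA _ J J) JJ.
rewrite (mulrA (f1 + f2) J) -cD -!mulrA -scalerDr -mulrDr.
congr (_ + _); first by apply: quatP => /=; field.
by rewrite -scalerAr !scalerAr; congr (_ * (_ * _)); apply: quatP => /=; field.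
Qed.

(** Both star products with the extension of the pointwise inverse are the
extension of the constant 1. *)
Lemma slice_ext_star_inverse (R : realType) (J : quat R)
    (f h : quat R -> quat R) :
  imag_units J -> slice_holomorphic J h ->
  (forall z, half_ball z -> h z != 0) ->
  (forall s, half_ball s -> f s = slice_ext J h s) ->
  is_star_inverse (@half_ball R) f (slice_ext J (fun z => (h z)^-1)).
Proof.
move=> SJ hol h0 fE.
have hJ x y : half_ball (slice_pt J x y) -> GRing.comm J (h (slice_pt J x y)).
  by move=> hz; have [] := hol J (x, y) (or_introl erefl) hz.
have hU z : half_ball z -> h z \is a GRing.unit by exact: h0.
split.
  apply: slice_ext_hyperholomorphic => // K p KJ hp.
  by apply: holomorphic_atV; [exact: h0|exact: hol].
move=> s hs; rewrite -(slice_ext_cst J 1 s).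
split.
  rewrite (eq_star_prod fE (fun _ _ => erefl) hs) slice_extM //.
  by apply: eq_slice_ext => // x y hz; rewrite mulrV ?hU.
rewrite (eq_star_prod (fun _ _ => erefl) fE hs) slice_extM // => [|x y hz].
  by apply: eq_slice_ext => // x y hz; rewrite mulVr ?hU.
by apply: commrV; exact: hJ.
Qed.

(** * The denominator of the kernel *)

Lemma qnormsqM (R : realType) (p q : quat R) :
  qnormsq (p * q) = qnormsq p * qnormsq q.
Proof. by rewrite /qnormsq /=; ring. Qed.

Lemma qnormsq_ge0 (R : realType) (q : quat R) : 0 <= qnormsq q.
Proof. by rewrite /qnormsq !addr_ge0 ?sqr_ge0. Qed.

Lemma half_ball_qnormsq_lt1 (R : realType) (q : quat R) :
  half_ball q -> qnormsq q < 1.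
Proof.
case=> + _; rewrite /qnorm => h.
by rewrite -(sqr_sqrtr (qnormsq_ge0 q)) expr_lt1 ?sqrtr_ge0.
Qed.

(** Because [|z| |r| < 1]. *)
Lemma one_sub_mul_conj_unit (R : realType) (z r : quat R) :
  half_ball z -> half_ball r -> 1 - z * qconj r \is a GRing.unit.
Proof.
move=> /half_ball_qnormsq_lt1 z1 /half_ball_qnormsq_lt1 r1.
change (1 - z * qconj r != 0); apply/eqP => /subr0_eq/(congr1 (@qnormsq R)).
have -> : qnormsq (1 : quat R) = 1 by rewrite /qnormsq /=; ring.
have -> : qnormsq (z * qconj r) = qnormsq z * qnormsq r.
  by rewrite qnormsqM /qnormsq /=; ring.
by move: (qnormsq_ge0 z) (qnormsq_ge0 r) => *; nra.
Qed.

(** Because both real parts are positive. *)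
Lemma add_conj_unit (R : realType) (z r : quat R) :
  half_ball z -> half_ball r -> z + qconj r \is a GRing.unit.
Proof.
move=> [_ z0] [_ r0]; change (z + qconj r != 0).
by apply/eqP => /(congr1 (@qre R)) /=; lra.
Qed.

Lemma slice_holomorphic_affineM (R : realType) (J c : quat R) :
  GRing.comm J c -> slice_holomorphic J (fun z => (1 - z * c) * (z + c)).
Proof.
move=> cJ K p KJ _.
have cK : GRing.comm K c.
  by case: KJ => -> //; apply/commr_sym/commrN/commr_sym.
have hs := @holomorphic_at_slice_pt _ K p; have hc := holomorphic_at_cst p cK.
apply: holomorphic_atM; last exact: holomorphic_atD.
apply: holomorphic_atD; first exact: holomorphic_at_cst (commr1 _).
exact/holomorphic_atN/holomorphic_atM.
Qed.

(** Both factors are the extensions of their own restrictions to [C_J], whose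
values commute with [J]. *)
Lemma star_prod_affine (R : realType) (J c : quat R) q :
  imag_units J -> GRing.comm J c -> half_ball q ->
  star_prod (fun s => 1 - s * c) (fun s => s + c) q
    = slice_ext J (fun z => (1 - z * c) * (z + c)) q.
Proof.
move=> SJ cJ hq.
have e1 : slice_ext J (fun z => 1 - z * c) = fun s => 1 - s * c.
  apply/funext => s; have -> : (fun z => 1 - z * c) = (fun z => z * - c + 1).
    by apply/funext => z; rewrite mulrN addrC.
  by rewrite slice_ext_affine // mulrN addrC.
have e2 : slice_ext J (fun z => z + c) = fun s => s + c.
  apply/funext => s; have -> : (fun z => z + c) = (fun z => z * 1 + c).
    by apply/funext => z; rewrite mulr1.
  by rewrite slice_ext_affine // mulr1.
rewrite -e1 -e2 slice_extM // => x y _; apply: commrB; first exact: commr1.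
by apply: commrM => //; exact: comm_slice_pt.
Qed.

(** The algebraic identity behind the formula:
[(1 - z c)^2 + (z + c)^2 = (1 + z^2)(1 + c^2)], the cross terms [2 z c]
cancelling. *)
Lemma sum_inv_sqr_factor (S : unitRingType) (z c : S) :
  GRing.comm z c -> 1 - z * c \is a GRing.unit -> z + c \is a GRing.unit ->
  let u := (1 - z * c) * (z + c) in
  (1 - z * c) ^- 2 + (z + c) ^- 2
    = (1 + z ^+ 2) * ((u * u)^-1 * (1 + c ^+ 2)).
Proof.
move=> zc; set P := 1 - z * c; set Q := z + c => uP uQ u.
have czP : GRing.comm c P.
  by apply: commrB; [exact: commr1|apply: commrM => //; exact: commr_sym].
have cPQ : GRing.comm P Q.
  apply/commr_sym; rewrite /Q /P; apply: commrB; first exact: commr1.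
  rewrite /GRing.comm mulrDl mulrDr -(mulrA z c z) -zc.
  by rewrite (mulrA z z c) -!mulrA (mulrA c) -zc -mulrA.
have PQ2 : P ^+ 2 + Q ^+ 2 = (1 + z ^+ 2) * (1 + c ^+ 2).
  have zczc : z * c * (z * c) = z ^+ 2 * c ^+ 2.
    by rewrite -!mulrA (mulrA c) -zc !expr2 !mulrA.
  rewrite (expr2 P) /P mulrBl !mulrBr !mul1r mulr1 zczc.
  rewrite (expr2 Q) /Q mulrDl !mulrDr !mulrDl -zc !mul1r mulr1 -!expr2.
  rewrite opprB [z ^+ 2 + z * c]addrC [X in _ + X]addrACA [X in X + _]addrACA.
  by rewrite -opprD [LHS]addrA subrK addrACA [z ^+ 2 * c ^+ 2 + _]addrC.
have uu : u * u = P ^+ 2 * Q ^+ 2.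
  by rewrite /u -mulrA (mulrA Q) -cPQ !expr2 !mulrA.
have uW : P ^+ 2 * Q ^+ 2 \is a GRing.unit.
  by rewrite unitrMl ?unitrX // unitrX.
have cW : GRing.comm (1 + c ^+ 2) (P ^+ 2 * Q ^+ 2).
  have cQ : GRing.comm c Q by apply: commrD => //; exact: commr_sym.
  apply/commr_sym/commrD; first exact: commr1.
  by apply/commrX/commr_sym/commrM; exact: commrX.
rewrite uu; apply: (mulIr uW).
rewrite mulrDl mulKr ?unitrX // -[RHS]mulrA -(mulrA (_ ^-1)) cW mulKr // -PQ2.
have -> : P ^+ 2 * Q ^+ 2 = Q ^+ 2 * P ^+ 2.
  by apply/commrX/commr_sym/commrX/commr_sym.
by rewrite mulKr ?unitrX // addrC.
Qed.

Theorem theorem5p3 (R : realType) (q r J : quat R)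
    (hq : half_ball q) (hr : half_ball r)
    (hJ : imag_units J) (hrJ : complex_slice J r) :
  let F := star_prod (fun s : quat R => 1 - s * qconj r)
                     (fun s : quat R => s + qconj r) in
  star_invertible (@half_ball R) (star_prod F F) /\
  slice_bergman J q r =
    (1 + q ^+ 2) * star_inv_sq (@half_ball R) F q * (1 + qconj r ^+ 2).
Proof.
move=> F; set c := qconj r.
have cJ : GRing.comm J c.
  have [a [b rE]] := hrJ; rewrite /c rE -slice_ptN //; exact: comm_slice_pt.
pose u (z : quat R) := (1 - z * c) * (z + c).
have uhol : slice_holomorphic J u by exact: slice_holomorphic_affineM.
have FE s : half_ball s -> F s = slice_ext J u s by exact: star_prod_affine.
have FFE s : half_ball s ->
    star_prod F F s = slice_ext J (fun z => u z * u z) s.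
  move=> hs; rewrite (eq_star_prod FE FE hs) slice_extM // => x y hz.
  by have [] := uhol J (x, y) (or_introl erefl) hz.
have GP : is_star_inverse (@half_ball R) (star_prod F F)
    (slice_ext J (fun z => (u z * u z)^-1)).
  apply: slice_ext_star_inverse => // [K p KJ hp|z hz].
    by apply: holomorphic_atM; exact: uhol.
  have uz : u z \is a GRing.unit
    by rewrite /u unitrMl ?one_sub_mul_conj_unit ?add_conj_unit.
  by have : u z * u z \is a GRing.unit by rewrite unitrMl.
split; first by eexists; exact: GP.
have [a [b hFF]] : exists a b,
    slice_components (@half_ball R) (star_prod F F) a b.
  have [eo _] := slice_ext_components (@half_ball R) u hJ.
  have hF : slice_components (@half_ball R) F (ext_alpha J u) (ext_beta J u).
    split=> // I x y SI hs; rewrite FE //.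
    exact: (slice_ext_components (@half_ball R) u hJ).2.
  by eexists; eexists; exact: (slice_components_star hF hF).
rewrite /star_inv_sq (star_invE hFF GP hq) -mulrA -slice_extMr.
rewrite -(@slice_ext_intrinsicM _ J (fun x y => 1 + x ^+ 2 - y ^+ 2)
  (fun x y => 2 * x * y) (fun z => 1 + z ^+ 2)) => [|//|K x y]; last first.
  exact: slice_pt_1Dsqr.
apply: eq_slice_ext => // x y hz; apply: sum_inv_sqr_factor.
- exact: slice_pt_comm.
- exact: one_sub_mul_conj_unit.
- exact: add_conj_unit.
Qed.
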